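(* Let $m\ge 1$, $d\ge 2$, let $\Lambda$ be a connected region of $\mathbb{Z}^m$, let $S$ be a subset of $\Lambda$, and let $\bar h:S\to\mathcal T$ be a graph homomorphism to the $d$-regular tree $\mathcal T$ which conserves the parity. There exists a graph homomorphism $h:\Lambda\to\mathcal T$ such that $h=\bar h$ on $S$ if and only if for all $x,y\in S$ $$d_{\mathcal T}(\bar h(x),\bar h(y))\le d_\Lambda(x,y).$$
   Context: $\mathcal T$ is the infinite $d$-regular tree, $d_{\mathcal T}$ its graph distance. $\Lambda\subset\mathbb{Z}^m$ is regarded as an induced subgraph of the nearest-neighbour graph of $\mathbb{Z}^m$ and $d_\Lambda$ is its graph distance. For $A\subset\mathbb{Z}^m$, $h:A\to\mathcal T$ is a graph homomorphism if $d_{\mathcal T}(h(x),h(y))=1$ for all $x,y\in A$ with $|x-y|_{\ell_1}=1$. Fix proper 2-colourings of the bipartite graphs $\mathbb{Z}^m$ and $\mathcal T$; the colour of a vertex is its parity. $\bar h$ conserves the parity if $\bar h(x)$ has the same parity as $x$ for every $x\in S$. *)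

(* Defs.v *)
From mathcomp Require Import all_boot all_order all_algebra.
From mathcomp Require Import boolp classical_sets.
Set Implicit Arguments.
Unset Strict Implicit.
Unset Printing Implicit Defensive.
Import GRing.Theory Num.Theory.
Local Open Scope ring_scope.

(* A graph on a (possibly infinite) vertex type [V] is its adjacency relation
   [e : rel V]. *)

Definition walk (V : Type) (e : rel V) (x y : V) (n : nat) : Prop :=
  exists p : seq V, [/\ path e x p, last x p = y & size p = n].

(* Length of a shortest walk from x to y. The value 0 when there is no walk is
   a dummy, irrelevant in connected graphs. *)
Definition gdist (V : Type) (e : rel V) (x y : V) : nat :=
  match pselect (exists n, `[< walk e x y n >]) with
  | left ex => ex_minn ex
  | right _ => 0%N
  end.

(* The vertex type is unchanged: vertices outside [A] become isolated. *)
Definition induced (V : Type) (e : rel V) (A : set V) : rel V :=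
  fun x y => [&& x \in A, y \in A & e x y].

Definition connected_in (V : Type) (e : rel V) (A : set V) : Prop :=
  forall x y, A x -> A y -> exists n, walk (induced e A) x y n.

Definition simple_graph (V : Type) (e : rel V) : Prop :=
  symmetric e /\ irreflexive e.

(* In a simple graph every edge gives a [ucycle] of size 2, hence the bound. *)
Definition acyclic (V : eqType) (e : rel V) : Prop :=
  forall c : seq V, ucycle e c -> (size c <= 2)%N.

Definition tree (V : eqType) (e : rel V) : Prop :=
  [/\ inhabited V, simple_graph e, connected_in e setT & acyclic e].

Definition regular (V : eqType) (e : rel V) (d : nat) : Prop :=
  forall x : V, exists s : seq V,
    [/\ uniq s, size s = d & forall y, (y \in s) = e x y].

(* For d >= 2 such a tree is automatically infinite, and it is unique up to
   isomorphism. *)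
Definition regular_tree (V : eqType) (e : rel V) (d : nat) : Prop :=
  tree e /\ regular e d.

Definition proper_2colouring (V : Type) (e : rel V) (c : V -> bool) : Prop :=
  forall x y, e x y -> c x != c y.

Definition l1norm (m : nat) (x : 'rV[int]_m) : int := \sum_(i < m) `|x 0 i|.

Definition Zadj (m : nat) : rel 'rV[int]_m := fun x y => l1norm (x - y) == 1.

Definition dist_in (m : nat) (Lambda : set 'rV[int]_m) : 'rV[int]_m ->
  'rV[int]_m -> nat := gdist (induced (@Zadj m) Lambda).

(* Functions on a subset [A] of Z^m are represented by total functions, of
   which only the values on [A] matter. *)
Definition graph_hom (m : nat) (T : eqType) (eT : rel T)
    (A : set 'rV[int]_m) (h : 'rV[int]_m -> T) : Prop :=
  forall x y, A x -> A y -> l1norm (x - y) = 1 -> gdist eT (h x) (h y) = 1%N.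

Definition conserves_parity (m : nat) (T : eqType) (cZ : 'rV[int]_m -> bool)
    (cT : T -> bool) (S : set 'rV[int]_m) (h : 'rV[int]_m -> T) : Prop :=
  forall x, S x -> cT (h x) = cZ x.

(* Main.v *)
(** Root the tree at a point [o] of the image of [hbar]. The value wanted at [v]
    lies in every ball [B(hbar s, d(s, v))], so take the ball farthest from [o],
    at distance [k = max_s (d(o, hbar s) - d(s, v))], and its point closest to
    [o], the ancestor of depth [k] of [hbar s]. The Lipschitz condition makes
    this point independent of the maximizing [s], and bounds [k] even when [S]
    is infinite. When no such difference is positive, alternate between [o] and
    a neighbour of [o] according to parity. Moving [v] to a neighbour changes
    [k] by at most one, and parity excludes equality when [k > 0]; a maximizer
    for the larger [k] is then one for the smaller [k] too, so the two values
    are consecutive ancestors of one point. *)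
Require Import Defs.
From mathcomp Require Import all_boot all_order all_algebra.
From mathcomp Require Import boolp classical_sets.
From mathcomp Require Import zify.
Set Implicit Arguments.
Unset Strict Implicit.
Unset Printing Implicit Defensive.
Local Open Scope ring_scope.
Local Open Scope classical_set_scope.

(** * Walks, graph distance and parity *)

Lemma gdist_le (V : Type) (e : rel V) (x y : V) (n : nat) :
  walk e x y n -> (gdist e x y <= n)%N.
Proof.
rewrite /gdist => w; case: pselect => // ex.
by case: ex_minnP => k _; apply; apply/asboolP.
Qed.

Lemma gdist_walk (V : Type) (e : rel V) (x y : V) :
  (exists n, walk e x y n) -> walk e x y (gdist e x y).
Proof.
case=> n w; rewrite /gdist; case: pselect => [ex|[]].
  by case: ex_minnP => k /asboolP.
by exists n; apply/asboolP.
Qed.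

Lemma walk0 (V : Type) (e : rel V) (x : V) : walk e x x 0.
Proof. by exists [::]. Qed.

Lemma walk0_eq (V : Type) (e : rel V) (x y : V) : walk e x y 0 -> x = y.
Proof. by case=> -[|z p] []. Qed.

Lemma walk1 (V : Type) (e : rel V) (x y : V) : e x y -> walk e x y 1.
Proof. by move=> exy; exists [:: y]; rewrite /= exy. Qed.

Lemma walk_cat (V : Type) (e : rel V) (x y z : V) (n k : nat) :
  walk e x y n -> walk e y z k -> walk e x z (n + k).
Proof.
move=> [p [pp lp sp]] [q [pq lq sq]]; exists (p ++ q).
by rewrite cat_path last_cat size_cat pp lp pq lq sp sq.
Qed.

Lemma walkS (V : Type) (e : rel V) (x y : V) (n : nat) :
  walk e x y n.+1 -> exists2 z, e x z & walk e z y n.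
Proof.
by move=> [[|z p] [] //= /andP[exz pp] lp [sp]]; exists z => //; exists p.
Qed.

Lemma walk_sym (V : Type) (e : rel V) (x y : V) (n : nat) :
  symmetric e -> walk e x y n -> walk e y x n.
Proof.
move=> syme; elim: n x y => [|n IH] x y.
  by move=> /(@walk0_eq V) <-; apply: walk0.
move=> /(@walkS V)[z exz /IH w]; rewrite -addn1; apply: walk_cat w _.
by apply: walk1; rewrite syme.
Qed.

Lemma walk_colour (V : Type) (e : rel V) (c : V -> bool) (x y : V) (n : nat) :
  proper_2colouring e c -> walk e x y n -> c x (+) c y = odd n.
Proof.
move=> hc; elim: n x => [|n IH] x.
  by move=> /(@walk0_eq V) <-; rewrite addbb.
move=> /(@walkS V)[z /hc + /IH /= <-].
by case: (c x); case: (c z); case: (c y).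
Qed.

Lemma walk_hom (V W : Type) (e : rel V) (e' : rel W) (h : V -> W)
    (x y : V) (n : nat) :
  (forall u v, e u v -> e' (h u) (h v)) ->
  walk e x y n -> walk e' (h x) (h y) n.
Proof.
move=> hh; elim: n x => [|n IH] x.
  by move=> /(@walk0_eq V) <-; apply: walk0.
by move=> /(@walkS V)[z /hh /(@walk1 W) exz /IH]; apply: walk_cat exz.
Qed.

(** The value 1 cannot be the dummy 0, so a walk exists; irreflexivity excludes distance 0 across an
    edge. *)
Lemma gdist_eq1 (V : Type) (e : rel V) (x y : V) :
  irreflexive e -> gdist e x y = 1%N <-> e x y.
Proof.
move=> irr; split=> [g1|exy].
  have [|] := pselect (exists n, walk e x y n).
    by move=> /(@gdist_walk V); rewrite g1 => /(@walkS V)[z exz /(@walk0_eq V) <-].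
  move=> nw; move: g1; rewrite /gdist; case: pselect => // -[n wn].
  by case: nw; exists n; apply/asboolP.
have w := walk1 exy.
have := gdist_le w; case Eg: (gdist e x y) => [|[|k]] // _.
have := gdist_walk (ex_intro _ _ w); rewrite Eg => /(@walk0_eq V) xy.
by move: exy; rewrite -xy irr.
Qed.

Lemma gdist_refl (V : Type) (e : rel V) (x : V) : gdist e x x = 0%N.
Proof. by apply/eqP; rewrite -leqn0; apply/gdist_le/walk0. Qed.

Lemma gdist_sym (V : Type) (e : rel V) (x y : V) :
  symmetric e -> (exists n, walk e x y n) -> gdist e x y = gdist e y x.
Proof.
move=> syme [n w]; apply/eqP; rewrite eqn_leq; apply/andP; split.
  by apply/gdist_le/walk_sym/gdist_walk => //; exists n; apply: walk_sym w.
by apply/gdist_le/walk_sym/gdist_walk => //; exists n.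
Qed.

Lemma gdist_triangle (V : Type) (e : rel V) (x y z : V) :
  (exists n, walk e x y n) -> (exists n, walk e y z n) ->
  (gdist e x z <= gdist e x y + gdist e y z)%N.
Proof.
by move=> wxy wyz; apply/gdist_le/walk_cat; apply: gdist_walk; eauto.
Qed.

Lemma induced_setT (V : Type) (e : rel V) : induced e setT = e.
Proof. by apply/funext => x; apply/funext => y; rewrite /induced !in_setT. Qed.

(** * Rooted trees: parents and ancestors *)

Lemma tree_walk (T : eqType) (e : rel T) (x y : T) :
  tree e -> exists n, walk e x y n.
Proof. by case=> _ _ conn _; have := conn x y I I; rewrite induced_setT. Qed.

Lemma path_from_root (T : eqType) (e : rel T) (o x : T) :
  (exists n, walk e o x n) ->
  exists p, [/\ path e o p, last o p = x &
    {in o :: p, forall u, (gdist e o u <= gdist e o x)%N}].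
Proof.
move=> /(@gdist_walk T)[p [pp lp sp]]; exists p; split=> // u.
move: pp lp sp => + + + up; case/splitPl: up => p1 p2 lu.
rewrite cat_path => /andP[pp1 _] _ <-; rewrite size_cat.
by apply: leq_trans (leq_addr _ _); apply: gdist_le; exists p1.
Qed.

(** Shortest walks from [o] to [y] and [z] stay at depths below that of [x], so they avoid [x].
    Joined at [o] and shortened, they give a simple path from [y] to [z], which [x] would close to a
    cycle of length at least 3 if [y] and [z] differed. *)
Lemma tree_parent_uniq (T : eqType) (e : rel T) (o x y z : T) :
  tree e -> e x y -> e x z -> (gdist e o y < gdist e o x)%N ->
  (gdist e o z < gdist e o x)%N -> y = z.
Proof.
move=> tre exy exz ly lz; apply/eqP; apply/negP => /negP yz.
have [_ [syme _] _ acy] := tre.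
have [p [pp lp dp]] := path_from_root (tree_walk o y tre).
have [q [pq lq dq]] := path_from_root (tree_walk o z tre).
have pr : path e y (rev (belast o p)).
  by rewrite -lp rev_path (eq_path (e' := e)) // => u v; rewrite syme.
have lr : last y (rev (belast o p)) = o.
  by case: p lp {pp dp pr} => [/= //|a p] lp; rewrite /= rev_cons last_rcons.
have : path e y (rev (belast o p) ++ q) by rewrite cat_path pr lr.
have : last y (rev (belast o p) ++ q) = z by rewrite last_cat lr.
have : x \notin y :: (rev (belast o p) ++ q).
  rewrite inE mem_cat mem_rev !negb_or; apply/and3P; split.
  - by apply/eqP => xy; move: ly; rewrite xy ltnn.
  - apply/negP => /mem_belast /dp; lia.
  - apply/negP => xq; have := dq x; rewrite inE xq orbT => /(_ isT); lia.
move=> + + hp; case/shortenP: hp => r pr' ur sub nx lz'.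
have nxr : x \notin y :: r.
  by apply: contra nx; rewrite !inE => /orP[-> //|/sub ->]; rewrite orbT.
suff /acy /= : ucycle e (x :: y :: r).
  by case: r lz' {pr' ur sub nxr} => //= yz'; rewrite yz' eqxx in yz.
by rewrite /ucycle /= rcons_path exy pr' lz' syme exz /= nxr -cons_uniq ur.
Qed.

(* [anc k x] is the vertex at depth [k] on the geodesic from [o] to [x]; the
   last item says that two geodesics from [o] agree up to the Gromov product of
   their end points. *)
Lemma tree_ancestors (T : eqType) (e : rel T) (c : T -> bool) (o : T) :
  tree e -> proper_2colouring e c ->
  exists anc : nat -> T -> T,
    [/\ forall x, anc (gdist e o x) x = x,
        forall k x, (k < gdist e o x)%N -> e (anc k x) (anc k.+1 x) &
        forall k x y, (gdist e x y + 2 * k <= gdist e o x + gdist e o y)%N ->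
          anc k x = anc k y].
Proof.
move=> tre hc; have [_ [syme irr] _ _] := tre.
have wT x y := tree_walk x y tre.
pose dep x := gdist e o x.
(* The triangle inequality bounds the change of depth along an edge by 1, and the colouring excludes
   0. *)
have depE x y : e x y -> (dep x = (dep y).+1 \/ dep y = (dep x).+1).
  move=> exy; have eyx : e y x by rewrite syme.
  have /= := walk_colour hc (gdist_walk (wT o x)).
  have /= := walk_colour hc (gdist_walk (wT o y)).
  have := gdist_triangle (wT o x) (wT x y).
  have := gdist_triangle (wT o y) (wT y x).
  have [[_ /(_ exy)->] [_ /(_ eyx)->]] := (gdist_eq1 x y irr, gdist_eq1 y x irr).
  move: (hc _ _ exy); rewrite -/(dep x) -/(dep y).
  by case: (c x); case: (c y); case: (c o) => //=; lia.
have /choice[par parP] x : exists y, (0 < dep x)%N -> e x y /\ dep x = (dep y).+1.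
  case Ed: (dep x) => [|n]; first by exists x.
  have : walk e x o (dep x) by apply/(walk_sym syme)/gdist_walk.
  rewrite Ed => /(@walkS T)[y exy wy]; exists y => _; split=> //.
  have := gdist_le (walk_sym syme wy); rewrite -/(dep y).
  by case: (depE _ _ exy); lia.
have parE x y : e x y -> dep x = (dep y).+1 -> par x = y.
  move=> exy dx; have [|ep dp] := parP x; first by rewrite dx.
  by apply: (@tree_parent_uniq _ e o x) => //; rewrite -/(dep _) -/(dep x); lia.
(* Climb from [x] to depth [k]. *)
exists (fun k x => iter (dep x - k) par x); split=> [x|k x kx|k x y].
- by rewrite -/(dep x) subnn.
- have dit j : (j <= dep x)%N -> dep (iter j par x) = (dep x - j)%N.
    elim: j => [|j IH] jx /=; first by rewrite subn0.
    have := parP (iter j par x); rewrite IH; [lia|exact: ltnW].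
  rewrite -/(dep x) in kx.
  have -> : (dep x - k = (dep x - k.+1).+1)%N by lia.
  rewrite iterS syme; apply: (parP _ _).1; rewrite dit; lia.
(* Induction along a walk of any length [n] from [x] to [y]: of two consecutive vertices one is the
   parent of the other. The hypothesis on [k] keeps it at most both depths, so the subtractions do
   not truncate. *)
have := gdist_walk (wT x y); rewrite -/(dep x) -/(dep y).
move: (gdist e x y) => n; elim: n x => [|n IH] x.
  by move=> /(@walk0_eq T) ->.
move=> /(@walkS T)[z exz wz] hk.
have := gdist_triangle (wT o z) (wT z y); have := gdist_le wz.
rewrite -/(dep y) -/(dep z) => h1 h2.
case: (depE _ _ exz) => dxz.
  rewrite -(IH z wz); last by lia.
  have -> : (dep x - k = (dep z - k).+1)%N by lia.
  by rewrite iterSr (parE x z).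
rewrite -(IH z wz); last by lia.
have -> : (dep z - k = (dep x - k).+1)%N by lia.
by rewrite iterSr (parE z x) // syme.
Qed.

(** * Extension of Lipschitz maps into a tree *)

Lemma Zadj_sym (m : nat) : symmetric (@Zadj m).
Proof.
move=> x y; rewrite /Zadj /l1norm; congr (_ == _).
by apply: eq_bigr => i _; rewrite !mxE Num.Theory.distrC.
Qed.

Lemma induced_sym (V : Type) (e : rel V) (A : set V) :
  symmetric e -> symmetric (induced e A).
Proof. by move=> se x y; rewrite /induced se andbCA. Qed.

Lemma max_attained (P : nat -> Prop) (B : nat) :
  (forall n, P n -> (n <= B)%N) ->
  exists k, (forall n, P n -> (n <= k)%N) /\ ((0 < k)%N -> P k).
Proof.
elim: B => [|B IH] hB; first by exists 0%N.
have [PB|nPB] := pselect (P B.+1); first by exists B.+1.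
apply: IH => n Pn; have := hB n Pn.
by rewrite leq_eqVlt => /orP[/eqP nB|//]; rewrite nB in Pn.
Qed.

Lemma tree_lipschitz_extension (V : Type) (g : rel V) (cV : V -> bool)
    (T : eqType) (e : rel T) (cT : T -> bool) (L S : set V) (f : V -> T) :
  symmetric g -> proper_2colouring g cV -> connected_in g L -> S `<=` L ->
  tree e -> proper_2colouring e cT -> (forall x, exists y, e x y) ->
  (forall x, S x -> cT (f x) = cV x) ->
  (forall x y, S x -> S y ->
    (gdist e (f x) (f y) <= gdist (induced g L) x y)%N) ->
  exists h : V -> T,
    (forall x y, L x -> L y -> g x y -> e (h x) (h y)) /\
    (forall x, S x -> h x = f x).
Proof.
move=> symg hcV conn SL tre hcT nbr par lip.
have [[t0] [syme irr] _ _] := tre.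
have wT x y := tree_walk x y tre.
pose dL := gdist (induced g L); pose dT := gdist e.
have dLsym x y : L x -> L y -> dL x y = dL y x.
  by move=> Lx Ly; apply: gdist_sym (conn _ _ Lx Ly); apply: induced_sym.
have dLtri x y z : L x -> L y -> L z -> (dL x z <= dL x y + dL y z)%N.
  by move=> Lx Ly Lz; apply: gdist_triangle; apply: conn.
have dLodd x y : L x -> L y -> cV x (+) cV y = odd (dL x y).
  move=> Lx Ly; apply: walk_colour (gdist_walk (conn _ _ Lx Ly)).
  by move=> u v /and3P[_ _]; apply: hcV.
have dTsym x y : dT x y = dT y x by apply: gdist_sym.
have dTtri x y z : (dT x z <= dT x y + dT y z)%N by apply: gdist_triangle.
have dTodd x y : cT x (+) cT y = odd (dT x y).
  by apply: walk_colour (gdist_walk (wT x y)).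
(* With [o] equal to [f s0], the Lipschitz condition and the triangle inequality through [s0] give
   the bound [dL s0 v], uniform in [s]. *)
have [o obd] : exists o, forall v, L v -> exists B, forall s, S s ->
    (dT o (f s) <= dL s v + B)%N.
  have [[s0 Ss0]|nS] := pselect (exists s, S s); last first.
    by exists t0 => v _; exists 0%N => s Ss; case: nS; exists s.
  exists (f s0) => v Lv; exists (dL s0 v) => s Ss.
  apply: leq_trans (lip _ _ Ss0 Ss) _.
  rewrite addnC (dLsym s v) //; last exact: SL.
  by apply: dLtri => //; apply: SL.
have [o' eoo'] := nbr o.
have [anc [ancE ancS ancU]] := tree_ancestors o tre hcT.
have anc0 x : anc 0%N x = o.
  have := ancE o; rewrite gdist_refl => {1}<-; apply: ancU.
  by rewrite gdist_refl -/(dT x o) -/(dT o x) dTsym muln0.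
pose base v := if cV v == cT o then o else o'.
(* [k] is the maximum over [s] of [dT o (f s) - dL s v], cut off at 0, and [t] is a value prescribed
   by it. *)
pose R v k t := (forall s, S s -> (dT o (f s) <= dL s v + k)%N) /\
  (k = 0%N /\ t = base v \/
   (0 < k)%N /\ exists s, [/\ S s, dT o (f s) = (dL s v + k)%N & t = anc k (f s)]).
have /choice[h hP] v : exists t, L v -> exists k, R v k t.
  have [Lv|nLv] := pselect (L v); last by exists t0.
  have [B hB] := obd v Lv.
  have [|k [kmax katt]] := @max_attained
    (fun k => exists2 s, S s & dT o (f s) = (dL s v + k)%N) B.
    by move=> n [s Ss sn]; have := hB s Ss; rewrite sn leq_add2l.
  have kP s : S s -> (dT o (f s) <= dL s v + k)%N.
    move=> Ss; have [le|lt] := leqP (dT o (f s)) (dL s v); first by lia.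
    have := kmax (dT o (f s) - dL s v)%N; rewrite leq_subLR; apply.
    by exists s => //; lia.
  have [k0|/[dup] k0 /katt[s Ss sk]] := posnP k.
    by exists (base v) => _; exists k; split=> //; left.
  by exists (anc k (f s)) => _; exists k; split=> //; right; split=> //; exists s.
have dL1 s v w : S s -> L v -> L w -> g v w -> (dL s w <= dL s v + 1)%N.
  move=> Ss Lv Lw gvw; apply: gdist_le; apply: walk_cat.
    by apply: gdist_walk; apply: conn => //; apply: SL.
  by apply: walk1; rewrite /induced gvw !mem_set.
have step v w k l tv tw : L v -> L w -> g v w -> R v k tv -> R w l tw ->
    (l < k)%N -> e tw tv.
  move=> Lv Lw gvw [_ [[-> //]|[k0 [s [Ss sk ->]]]]] [lmax lcase] lk.
  (* The maximizer [s] at [v] loses at most 1 on moving to [w], so it is also a maximizer there. *)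
  have := dL1 s v w Ss Lv Lw gvw; have := lmax s Ss; rewrite sk => h1 h2.
  have kE : k = l.+1 by lia.
  have sw : dT o (f s) = (dL s w + l)%N by lia.
  suff -> : tw = anc l (f s) by rewrite kE; apply: ancS; rewrite -/(dT _ _) sw; lia.
  case: lcase => [[l0 ->]|[l0 [s' [Ss' sl' ->]]]].
    (* Here [dT o (f s)] equals [dL s w], so [w] has the parity of [o] and [base w] is [o]. *)
    rewrite l0 anc0 /base; case: eqP => // ne; case: ne.
    have := dTodd o (f s); have := dLodd s w (SL _ Ss) Lw.
    rewrite par // sw l0 addn0 => <-.
    by case: (cT o); case: (cV s); case: (cV w).
  (* Two maximizers at [w]: their images are at most [dL s' w + dL s w] apart, and adding [2 * l]
     gives the sum of their depths. *)
  apply: ancU; rewrite -/(dT o _) -/(dT o _) sw sl'.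
  have := lip s' s Ss' Ss; rewrite -/(dL _ _).
  have := dLtri s' w s (SL _ Ss') Lw (SL _ Ss).
  rewrite [dL w s]dLsym //; [lia|exact: SL].
exists h; split=> [v w Lv Lw gvw|s Ss].
  have gwv : g w v by rewrite symg.
  have [[k Rk] [l Rl]] := (hP v Lv, hP w Lw).
  have [lk|kl|E] := ltngtP l k.
  - by rewrite syme; apply: step Rk Rl lk.
  - by apply: step Rl Rk kl.
  move: Rk Rl; rewrite E => -[_ [[k0 ->]|[k0 [s [Ss sk _]]]]].
    move=> [_ [[_ ->]|[]]]; last by rewrite k0.
    have := hcV v w gvw; rewrite /base.
    by case: (cV v); case: (cV w); case: (cT o) => //= _; rewrite // syme.
  (* Equal positive maxima are impossible: each equality fixes the parity of its vertex from that of
     [o] and [k], yet [v] and [w] have opposite parities. *)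
  move=> [_ [[k0']|[_ [s' [Ss' sk' _]]]]]; first by rewrite k0' in k0.
  have := hcV v w gvw.
  have := dTodd o (f s); have := dTodd o (f s').
  rewrite sk sk' !oddD -!dLodd //; try exact: SL.
  rewrite !par //.
  by case: (cT o); case: (cV s); case: (cV s'); case: (cV v); case: (cV w); case: (odd k).
(* On [S] the maximum is the depth of [f s]: [s] itself gives one inequality and the Lipschitz
   condition the other. The ancestor of [f s] at that depth is [f s]. *)
have [k [kmax kcase]] := hP s (SL _ Ss).
have := kmax s Ss; rewrite {1}/dL gdist_refl add0n => h1.
case: kcase => [[k0 ->]|[k0 [s' [Ss' sk ->]]]].
  have o0 : dT o (f s) = 0%N by lia.
  have fo : f s = o by rewrite -[LHS]ancE -/(dT _ _) o0 anc0.
  by rewrite /base -par // fo eqxx.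
have := lip s' s Ss' Ss; rewrite -/(dL s' s) -/(dT _ _) => h2.
have := dTtri o (f s) (f s'); rewrite [dT (f s) _]dTsym => h3.
rewrite -[RHS]ancE; have -> : gdist e o (f s) = k by rewrite -/(dT _ _); lia.
by apply: ancU; rewrite -!/(dT _ _); lia.
Qed.

(** * Homomorphisms from regions of the lattice *)

Theorem theorem3p9 (m d : nat) (hm : (1 <= m)%N) (hd : (2 <= d)%N)
    (T : eqType) (eT : rel T) (hT : regular_tree eT d)
    (cZ : 'rV[int]_m -> bool) (hcZ : proper_2colouring (@Zadj m) cZ)
    (cT : T -> bool) (hcT : proper_2colouring eT cT)
    (Lambda S : set 'rV[int]_m)
    (hLambda : connected_in (@Zadj m) Lambda) (hS : S `<=` Lambda)
    (hbar : 'rV[int]_m -> T) (hhom : graph_hom eT S hbar)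
    (hpar : conserves_parity cZ cT S hbar) :
  (exists h : 'rV[int]_m -> T,
      graph_hom eT Lambda h /\ (forall x, S x -> h x = hbar x)) <->
  (forall x y, S x -> S y ->
      (gdist eT (hbar x) (hbar y) <= dist_in Lambda x y)%N).
Proof.
have [tre reg] := hT; have [_ [_ irr] _ _] := tre.
split=> [[h [hh hE]] x y Sx Sy|lip].
  (* A homomorphism carries a shortest walk in [Lambda] to a walk of the same length in the tree. *)
  rewrite -!hE //; apply: gdist_le.
  apply: walk_hom (gdist_walk (hLambda _ _ (hS _ Sx) (hS _ Sy))).
  move=> u v /and3P[/set_mem Lu /set_mem Lv /eqP uv].
  by apply/(gdist_eq1 _ _ irr)/hh.
(* Positive degree supplies the neighbour with which the root alternates. *)
have nbr x : exists y, eT x y.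
  have [[|y s] [_ sz sP]] := reg x; first by rewrite -sz in hd.
  by exists y; rewrite -sP mem_head.
have [h [hh hE]] := tree_lipschitz_extension (@Zadj_sym m) hcZ hLambda hS tre
  hcT nbr hpar lip.
exists h; split=> // x y Lx Ly xy.
by apply/(gdist_eq1 _ _ irr)/hh => //; apply/eqP.
Qed.
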